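(* Let $\chi$ be an uncountable limit cardinal that is not a fixed point of the aleph function, and let $\lambda$ be a cardinal with $\chi<\lambda<\chi^{+\chi}$. Then $\alpha(\chi)\leq\lambda$. Moreover there is an infinite cardinal $\sigma<\chi$ such that for every cardinal $\nu$ with $\sigma\leq\nu\leq\chi^+$, $\mathrm{cov}(\lambda,\nu,\nu,\sigma)\leq\lambda$ (and $\nu$ is a $\lambda$-revision cardinal).
   Context: A fixed point of the aleph function is a cardinal $\kappa$ with $\kappa=\aleph_\kappa$. $\chi^{+\alpha}$ denotes the $\alpha$-th cardinal successor of $\chi$. For a set $S$ and a cardinal $\tau$, $P_\tau(S)=\{x\subseteq S : |x|<\tau\}$. For cardinals $\rho_1,\rho_2,\rho_3,\rho_4$ with $\rho_1^+\geq\rho_2$, $\rho_2^+\geq\rho_3\geq\omega$ and $\rho_3\geq\rho_4\geq 2$, the covering number $\mathrm{cov}(\rho_1,\rho_2,\rho_3,\rho_4)$ is the least cardinality of any $X\subseteq P_{\rho_2}(\rho_1)$ such that for any $b\in P_{\rho_3}(\rho_1)$ there is $Q\in P_{\rho_4}(X)$ with $b\subseteq\bigcup Q$. For infinite cardinals $\nu\leq\lambda$, $\nu$ is a $\lambda$-revision cardinal if $\mathrm{cov}(\lambda,\nu,\nu,\sigma')\leq\lambda$ for some cardinal $\sigma'<\nu$ (with $\sigma'\geq 2$). For an uncountable limit cardinal $\chi$ and an infinite cardinal $\sigma<\chi$, $\alpha(\chi,\sigma)=\sup\{\mathrm{cov}(\tau,\nu,\nu,\sigma):\sigma\leq\nu\leq\tau<\chi\}$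 ($\tau,\nu$ cardinals), and $\alpha(\chi)=\min\{\alpha(\chi,\sigma):\omega\leq\sigma<\chi\}$. *)

(* Defs.v *)
From mathcomp Require Import all_boot.
From mathcomp Require Import boolp classical_sets cardinality wochoice.

Set Implicit Arguments.
Unset Strict Implicit.
Unset Printing Implicit Defensive.

Local Open Scope classical_set_scope.
Local Open Scope card_scope.

Declare Scope ord_scope.
Delimit Scope ord_scope with ord.
Local Open Scope ord_scope.

(* An ordinal is represented by a well-ordered type. Representatives are not
   quotiented: equality of ordinals is order isomorphism [=o], and every
   notion below is invariant under it. Predicates on [Ord] are written
   [Ord -> Prop] and not [set Ord], so that the universe of [set] is not forced
   above that of the carriers and [set a], [a : Ord], can itself be a carrier. *)
Record Ord := MkOrd {
  osort :> Type;
  orel : rel osort;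
  orel_wo : well_order orel }.

Definition oiso (a b : Ord) : Prop :=
  exists2 f : a -> b, bijective f & forall x y, orel (f x) (f y) = orel x y.
Notation "a =o b" := (oiso a b) (at level 70, no associativity) : ord_scope.

Section Segment.
Variables (a : Ord) (x : a).

(* [orel] is reflexive and total, so [~~ orel x y] says that y < x. *)
Definition seg_sort := {y : a | ~~ orel x y}.
Definition seg_rel : rel seg_sort := fun y z => orel (val y) (val z).

Lemma seg_wo : well_order seg_rel.
Proof.
move=> A [y0 Ay0].
pose B : {pred a} := fun y => `[< exists2 z, z \in A & val z = y >].
have inB z : z \in A -> val z \in B by move=> Az; apply/asboolP; exists z.
have /orel_wo : nonempty B by exists (val y0); exact: inB.
move=> [z [[/asboolP[y Ay yz] lb] uz]]; exists y; split.
  by split=> // w Aw; rewrite /seg_rel yz; apply/lb/inB.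
move=> w [Aw lbw]; apply: val_inj; rewrite /= yz; apply: uz; split.
  exact: inB.
by move=> v /asboolP[u Au <-]; exact: lbw.
Qed.

Definition seg : Ord := MkOrd seg_wo.
End Segment.

Definition olt (a b : Ord) : Prop := exists x : b, a =o seg x.
Notation "a <o b" := (olt a b) (at level 70, no associativity) : ord_scope.
Definition ole (a b : Ord) : Prop := a <o b \/ a =o b.
Notation "a <=o b" := (ole a b) (at level 70, no associativity) : ord_scope.

Lemma leq_wo : well_order leq.
Proof.
apply: antisymmetric_well_order; first exact: anti_leq.
move=> A neA; have [n An nmin] := ex_minnP neA.
by exists n; split=> // m; exact: nmin.
Qed.

Definition omega : Ord := MkOrd leq_wo.
Definition ofin (n : nat) : Ord := @seg omega n.

Lemma oiso_trans a b c : a =o b -> b =o c -> a =o c.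
Proof.
move=> [f bf fE] [g bg gE]; exists (g \o f); first exact: bij_comp.
by move=> x y; rewrite /= gE fE.
Qed.

Section WellOrder.
Variable a : Ord.

Lemma orel_chain : @wo_chain {classic a} (@orel a) predT.
Proof. by move=> A _ neA; exact: (@orel_wo a). Qed.

Lemma orel_refl : reflexive (@orel a).
Proof. by move=> x; exact: wo_chain_reflexive orel_chain _ _. Qed.

Lemma orel_anti : antisymmetric (@orel a).
Proof. by move=> x y; exact: wo_chain_antisymmetric orel_chain _ _ _ _. Qed.

Lemma orel_total : total (@orel a).
Proof. by move=> x y; exact: wo_chainW orel_chain _ _ _ _. Qed.

Lemma orel_trans : transitive (@orel a).
Proof.
move=> y x z xy yz.
pose A : {pred a} := pred3 (x : {classic a}) y z.
have [|m [[Am lb] _]] := @orel_wo a A.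
  by exists x; rewrite unfold_in /= eqxx.
have [lbx lby lbz] : [/\ orel m x, orel m y & orel m z].
  by split; apply: lb; rewrite unfold_in /= eqxx ?orbT.
move: (Am); rewrite unfold_in /= => /or3P[/eqP|/eqP|/eqP] mE.
- by rewrite -mE.
- by rewrite (@orel_anti x y) // xy -mE.
- by rewrite (@orel_anti z y) ?xy // yz -mE lby.
Qed.

Lemma orel_wf : well_founded (fun x y : a => ~~ orel y x).
Proof.
move=> x; apply: contrapT => Nx.
have [|m [[/asboolP Nm lb] _]] :=
    @orel_wo a (fun y => `[< ~ Acc (fun x y : a => ~~ orel y x) y >]).
  by exists x; exact/asboolP.
apply: Nm; constructor => y ym; apply: contrapT => Ny.
by move/negP: ym; apply; apply: lb; exact/asboolP.
Qed.
End WellOrder.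

Lemma seg_seg (a : Ord) (x : a) (y : seg x) : seg y =o seg (val y).
Proof.
have lt (z : seg y) : ~~ orel (val y) (val (val z)) := valP z.
have ltx (z : seg (val y)) : ~~ orel x (val z).
  apply/negP => xz; have /negP := valP y; apply.
  apply: orel_trans xz _; have /orP[//|yz] := orel_total (val z) (val y).
  by have := valP z; rewrite /= yz.
exists (fun z : seg y => exist _ (val (val z)) (lt z) : seg (val y)) => //.
exists (fun z : seg (val y) =>
  exist _ (exist _ (val z) (ltx z) : seg x) (valP z) : seg y) => z.
  by do 2 apply: val_inj.
exact: val_inj.
Qed.

Lemma seg_iso (a b : Ord) (f : a -> b) (x : a) : bijective f ->
  (forall y z, orel (f y) (f z) = orel y z) -> seg x =o seg (f x).
Proof.
move=> [g fK gK] fE.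
have lt (y : seg x) : ~~ orel (f x) (f (val y)) by rewrite fE; exact: valP y.
have gt (y : seg (f x)) : ~~ orel x (g (val y)).
  by rewrite -fE gK; exact: valP y.
exists (fun y : seg x => exist _ (f (val y)) (lt y) : seg (f x)).
  by exists (fun y : seg (f x) => exist _ (g (val y)) (gt y) : seg x) => y;
    apply: val_inj; rewrite /= ?fK ?gK.
by move=> y z; exact: fE.
Qed.

Lemma olt_wf : well_founded olt.
Proof.
suff acc (b : Ord) (x : b) (a : Ord) : a =o seg x -> Acc olt a.
  by move=> a; constructor=> c [x cx]; exact: acc cx.
elim/(well_founded_ind (@orel_wf b)): x a => x IH a [f bf fE].
constructor=> c [y cy]; apply: (IH (val (f y))); first exact: valP (f y).
apply: oiso_trans cy _; apply: oiso_trans (seg_iso _ bf fE) _.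
exact: seg_seg.
Qed.

(* The least ordinal, up to isomorphism, satisfying P. The default value 0 is
   reached only if no ordinal satisfies P, as [<=o] is a well-order. *)
Definition omin (P : Ord -> Prop) : Ord :=
  if pselect (exists a, P a /\ forall b, P b -> a <=o b) is left h
  then projT1 (cid h) else ofin 0.

Definition osup (P : Ord -> Prop) : Ord :=
  omin (fun b => forall a, P a -> a <=o b).

(* Cardinals are the initial ordinals. *)
Definition cardinal (k : Ord) : Prop :=
  forall a : Ord, a <o k -> ~ ([set: a] #= [set: k]).

Definition card T (A : set T) : Ord := omin (fun k => [set: k] #= A).

Definition card_succ (k : Ord) : Ord := omin (fun m => cardinal m /\ k <o m).

Definition limit_cardinal (k : Ord) : Prop :=
  [/\ cardinal k, ofin 0 <o k &
      forall m, cardinal m -> m <o k -> card_succ m <o k].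

(* [card_succ_iter k a] is the a-th cardinal successor k^{+a}: the least
   cardinal that is at least k and exceeds k^{+b} for all b < a. *)
Definition card_succ_iter (k : Ord) : Ord -> Ord :=
  Fix olt_wf (fun=> Ord) (fun a rec =>
    omin (fun m => [/\ cardinal m, k <=o m &
                       forall b (ba : b <o a), rec b ba <o m])).

Lemma card_succ_iterE k a : card_succ_iter k a =
  omin (fun m => [/\ cardinal m, k <=o m &
                     forall b, b <o a -> card_succ_iter k b <o m]).
Proof.
rewrite {1}/card_succ_iter Fix_eq // => x f g fg.
by congr omin; apply/funext => m; congr and3; apply/propext;
  split=> h b bx; [rewrite -fg | rewrite fg].
Qed.

Definition aleph (a : Ord) : Ord := card_succ_iter omega a.

Definition aleph_fixed_point (k : Ord) : Prop := k =o aleph k.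

(* x is an element of P_t(S). *)
Definition Psmall (t : Ord) T (S : set T) (x : set T) : Prop :=
  x `<=` S /\ card x <o t.

(* [cov r1 r2 r3 r4] is meant for cardinals satisfying
   r1^+ >= r2, r2^+ >= r3 >= omega and r3 >= r4 >= 2. *)
Definition covers (r1 r2 r3 r4 : Ord) (X : set (set r1)) : Prop :=
  (forall x, X x -> Psmall r2 [set: r1] x) /\
  (forall b, Psmall r3 [set: r1] b ->
     exists2 Q, Psmall r4 X Q & b `<=` \bigcup_(x in Q) x).

Definition cov (r1 r2 r3 r4 : Ord) : Ord :=
  omin (fun k => exists2 X, @covers r1 r2 r3 r4 X & k =o card X).

Definition revision_cardinal (lambda nu : Ord) : Prop :=
  [/\ cardinal lambda, cardinal nu, omega <=o nu, nu <=o lambda &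
      exists sigma, [/\ cardinal sigma, ofin 2 <=o sigma, sigma <o nu &
                        cov lambda nu nu sigma <=o lambda]].

(* The two-argument alpha(chi, sigma). *)
Definition alpha2 (chi sigma : Ord) : Ord :=
  osup (fun k => exists tau nu,
    [/\ cardinal tau, cardinal nu,
        [/\ sigma <=o nu, nu <=o tau & tau <o chi] &
        k =o cov tau nu nu sigma]).

Definition alpha (chi : Ord) : Ord :=
  omin (fun k => exists sigma,
    [/\ cardinal sigma, omega <=o sigma, sigma <o chi & k =o alpha2 chi sigma]).

(* Main.v *)
From mathcomp Require Import all_boot.
From mathcomp Require Import boolp classical_sets functions cardinality wochoice.
Require Import Defs.

Set Implicit Arguments.
Unset Strict Implicit.
Unset Printing Implicit Defensive.

Local Open Scope classical_set_scope.
Local Open Scope card_scope.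
Local Open Scope ord_scope.

(** The proof rests on counting cardinals. As [lambda] lies below the [chi]-th
    successor of [chi], it is at most the [b]-th successor of [chi] for some [b]
    below [chi]; as [chi] is not a fixed point of [aleph], it is at most [aleph d]
    for some [d] below [chi]. Hence the cardinals below [lambda] number at most
    some infinite cardinal [kappa] below [chi] ([few_cardinals]).

    Given an infinite cardinal [nu], induction on the ordinal [a], up to
    [lambda], then produces [lambda] many subsets of [a], each of size less than
    [nu], such that every subset of [a] of size less than [nu] is covered by
    [kappa] many of them ([coverable_ord]). If [a] has size less than [nu], then
    [a] itself is enough; if [a] is not a cardinal, it is equipotent to a smaller
    ordinal. If [a] is a limit of cardinals, it is the union of at most [kappa]
    segments ending at cardinals, and the families of these segments together
    cover what is needed. If [a] is a successor cardinal, it is regular, so that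
    a small subset is bounded and the family of a single segment is enough. The
    two unions stay within their bounds because an infinite ordinal is
    equipotent to its square ([card_square]).

    Any cardinal [sigma] above [kappa] thus gives [cov tau nu nu sigma <=o lambda]
    for all [tau] up to [lambda] and all infinite cardinals [nu]. With [tau] below
    [chi] this bounds [alpha chi]; with [tau] equal to [lambda] it is the second
    claim. *)

(** * Injections presented as relations *)

(** Relations spare the choice of values outside [A], hence any assumption that
    the target type is inhabited. *)
Lemma card_le_of_rel T U (A : set T) (B : set U) (R : T -> U -> Prop) :
  (forall x, A x -> exists2 y, B y & R x y) ->
  (forall x x' y, A x -> A x' -> R x y -> R x' y -> x = x') ->
  A #<= B.
Proof.
move=> Rtot Rinj; have [->|/set0P[x0 Ax0]] := eqVneq A set0.
  exact: card_ge0.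
have [y0 By0 _] := Rtot _ Ax0.
have /choice[f fP] : forall x, exists y, A x -> B y /\ R x y.
  move=> x; have [/Rtot[y By Rxy]|nAx] := pselect (A x); first by exists y.
  by exists y0.
have /injfunPex[g] : exists2 f : T -> U, set_fun A B f & set_inj A f.
  exists f => [x /fP[]//|x x' /set_mem Ax /set_mem Ax' fxx'].
  apply: (Rinj _ _ (f x)) => //; first by case: (fP _ Ax).
  by rewrite fxx'; case: (fP _ Ax').
exact: inj_card_le.
Qed.

Lemma card_le_rel T U (A : set T) (B : set U) : A #<= B ->
  exists R : T -> U -> Prop,
    [/\ forall x, A x -> exists2 y, B y & R x y,
        forall x x' y, R x y -> R x' y -> x = x' &
        forall x y y', R x y -> R x y' -> y = y'].
Proof.
move=> /card_leP[f].
exists (fun x y => exists2 u : A, val u = x & val (f u) = y).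
split=> [x Ax|x x' y [u <- fu] [u' <- fu']|x y y' [u ux <-] [u' u'x <-]].
- pose u : A := SigSub (mem_set Ax).
  by exists (val (f u)); [exact: set_mem (valP (f u)) | exists u].
- congr (val _); apply: (@inj _ _ _ f); rewrite ?inE//.
  by apply: val_inj; rewrite fu fu'.
- by congr (val (f _)); apply: val_inj; rewrite ux u'x.
Qed.

Lemma card_leX T U T' U' (A : set T) (B : set U) (A' : set T') (B' : set U') :
  A #<= B -> A' #<= B' -> A `*` A' #<= B `*` B'.
Proof.
move=> /card_le_rel[R [Rtot Rinj _]] /card_le_rel[R' [Rtot' Rinj' _]].
apply: (card_le_of_rel (R := fun p q => R p.1 q.1 /\ R' p.2 q.2)).
  move=> [x x'] [/= /Rtot[y By Rxy] /Rtot'[y' By' Rxy']].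
  by exists (y, y').
move=> [x x'] [z z'] [y y'] _ _ /= [Rxy Rxy'] [Rzy Rzy'].
by rewrite (Rinj _ _ _ Rxy Rzy) (Rinj' _ _ _ Rxy' Rzy').
Qed.

(** The union embeds into pairs (index, position in the member). *)
Lemma card_le_bigcupX I T U V (D : set I) (F : I -> set T) (B : set U)
    (C : set V) :
  D #<= B -> (forall i, D i -> F i #<= C) ->
  \bigcup_(i in D) F i #<= B `*` C.
Proof.
move=> /card_le_rel[R [Rtot Rinj _]] FC.
have /choice[S SP] : forall i, exists S : T -> V -> Prop, D i ->
    (forall x, F i x -> exists2 y, C y & S x y) /\
    (forall x x' y, S x y -> S x' y -> x = x').
  move=> i; have [/FC/card_le_rel[S [? ? _]]|nDi] := pselect (D i).
    by exists S.
  by exists (fun _ _ => True).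
apply: (card_le_of_rel
  (R := fun x p => exists i, [/\ D i, R i p.1 & S i x p.2])).
  move=> x [i Di Fix]; have [y By Riy] := Rtot _ Di.
  have [z Cz Sxz] := (SP _ Di).1 _ Fix.
  by exists (y, z); [|exists i].
move=> x x' [y z] _ _ /= [i [Di Riy Sixz]] [j [Dj Rjy Sjxz]].
rewrite -(Rinj _ _ _ Riy Rjy) in Sjxz.
exact: (SP _ Di).2 Sixz Sjxz.
Qed.

Lemma card_le_setU1 T (A : set T) (x : T) : infinite_set A -> x |` A #<= A.
Proof.
move=> /[dup] Ainf /infiniteP/card_le_rel[R [Rtot Rinj Rfun]].
have [Ax|nAx] := pselect (A x); first by rewrite setUidr// => _ ->.
(* Along the copy of nat in A given by R, shift by one to make room for x. *)
pose S z y := [\/ z = x /\ R 0 y, exists n, [/\ A z, R n z & R n.+1 y] |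
                 [/\ A z, z = y & forall n, ~ R n z]].
have Rtot' n : exists2 y, A y & R n y by exact: Rtot.
apply: (card_le_of_rel (R := S)).
  move=> z [->|Az].
    by have [y Ay R0y] := Rtot' 0; exists y => //; apply: Or31.
  have [[n Rnz]|nRz] := pselect (exists n, R n z).
    have [y Ay Ry] := Rtot' n.+1; exists y => //.
    by apply: Or32; exists n.
  by exists z => //; apply: Or33; split=> // n Rnz; apply: nRz; exists n.
move=> z z' y _ _ [[-> Ry]|[n [Az Rnz Ry]]|[Az zy nR]]
    [[-> Ry']|[n' [Az' Rnz' Ry']]|[Az' zy' nR']].
- by [].
- by have := Rinj _ _ _ Ry Ry'.
- by rewrite -zy' in Ry; case: (nR' _ Ry).
- by have := Rinj _ _ _ Ry Ry'.
- have [E] := Rinj _ _ _ Ry Ry'.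
  by rewrite -E in Rnz'; exact: Rfun Rnz Rnz'.
- by rewrite -zy' in Ry; case: (nR' _ Ry).
- by rewrite -zy in Ry'; case: (nR _ Ry').
- by rewrite -zy in Ry'; case: (nR _ Ry').
- by rewrite zy zy'.
Qed.

Lemma card_le_set1 T U (x : T) (A : set U) : infinite_set A -> [set x] #<= A.
Proof.
move=> /infiniteP; apply: card_le_trans; exact/finite_set_countable/finite_set1.
Qed.

(** * Comparison of ordinals *)

Lemma oiso_refl a : a =o a.
Proof. by exists id => //; exists id. Qed.

Lemma oiso_sym a b : a =o b -> b =o a.
Proof.
move=> [f [g fK gK] fE]; exists g; first by exists f.
by move=> x y; rewrite -fE !gK.
Qed.

Lemma oiso_card_eq a b : a =o b -> [set: a] #= [set: b].
Proof.
move=> [f [g fK gK] _]; rewrite card_eq_le; apply/andP; split.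
  apply: (card_le_of_rel (R := fun x y => y = f x)) => [x _|x x' y _ _ -> E].
    by exists (f x).
  exact: (can_inj fK).
apply: (card_le_of_rel (R := fun x y => y = g x)) => [x _|x x' y _ _ -> E].
  by exists (g x).
exact: (can_inj gK).
Qed.

Lemma seg_lt (a : Ord) (x y : a) : ~~ orel y x -> seg x <o seg y.
Proof.
by move=> xy; exists (exist _ x xy : seg y); exact/oiso_sym/seg_seg.
Qed.

Lemma seg_olt (a : Ord) (x : a) : seg x <o a.
Proof. by exists x; exact: oiso_refl. Qed.

Lemma oiso_olt a b c : a =o b -> b <o c -> a <o c.
Proof. by move=> ab [x bx]; exists x; exact: oiso_trans ab bx. Qed.

Lemma olt_oiso a b c : a <o b -> b =o c -> a <o c.
Proof.
move=> [x ax] [f bf fE]; exists (f x).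
by apply: oiso_trans ax _; exact: seg_iso.
Qed.

Lemma olt_trans a b c : a <o b -> b <o c -> a <o c.
Proof.
move=> ab [y bY]; have [x ax] := olt_oiso ab bY.
by exists (val x); apply: oiso_trans ax _; exact: seg_seg.
Qed.

Lemma olt_irr a : a <o a -> False.
Proof. by elim/(well_founded_ind olt_wf): a => a IH aa; exact: IH (aa) aa. Qed.

Lemma ole_refl a : a <=o a.
Proof. by right; exact: oiso_refl. Qed.

Lemma oltW a b : a <o b -> a <=o b.
Proof. by left. Qed.

Lemma ole_olt_trans a b c : a <=o b -> b <o c -> a <o c.
Proof. by move=> [ab|ab]; [exact: olt_trans | exact: oiso_olt]. Qed.

Lemma olt_ole_trans a b c : a <o b -> b <=o c -> a <o c.
Proof.
by move=> ab [bc|bc]; [exact: olt_trans ab bc | exact: olt_oiso ab bc].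
Qed.

Lemma ole_trans a b c : a <=o b -> b <=o c -> a <=o c.
Proof.
move=> [ab|ab] bc; first by left; exact: olt_ole_trans ab bc.
case: bc => bc; first by left; exact: oiso_olt ab bc.
by right; exact: oiso_trans ab bc.
Qed.

Lemma ole_oltF a b : a <=o b -> b <o a -> False.
Proof. by move=> ab ba; exact: (olt_irr (ole_olt_trans ab ba)). Qed.

Lemma ole_anti a b : a <=o b -> b <=o a -> a =o b.
Proof. by move=> [ab|//] ba; case: (ole_oltF ba ab). Qed.

Lemma nolt_orel (a : Ord) (x y : a) : ~ seg x <o seg y -> orel y x.
Proof. by move=> xy; case E: (orel y x) => //; case: xy; apply/seg_lt/negbT. Qed.

Lemma seg_inj (a : Ord) (x y : a) : seg x =o seg y -> x = y.
Proof.
move=> xy; apply: orel_anti; apply/andP; split; apply: nolt_orel => h.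
  exact: olt_irr (olt_oiso h xy).
exact: olt_irr (oiso_olt (oiso_sym xy) h).
Qed.

Lemma orel_seg (a : Ord) (x y : a) : orel x y = `[< seg x <=o seg y >].
Proof.
apply/idP/asboolP => [xy|xy]; last first.
  by apply: nolt_orel => yx; exact: ole_oltF xy yx.
case E: (orel y x); last by apply/oltW/seg_lt/negbT.
have -> : x = y by apply: orel_anti; rewrite xy.
exact: ole_refl.
Qed.

(** By induction on [a] each segment of [a] can be compared with [b]. If all of
    them are shorter than [b], sending each to the segment of [b] of the same
    type embeds [a] in [b] as a segment. *)
Lemma ole_or_olt a b : a <=o b \/ b <o a.
Proof.
elim/(well_founded_ind olt_wf): a b => a IH b.
have [[x bx]|nbx] := pselect (exists x : a, b <=o seg x).
  by right; exact: ole_olt_trans bx (seg_olt x).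
have /choice[f fP] : forall x : a, exists y : b, seg x =o seg y.
  move=> x; have [[[y xy]|xb]|bx] := IH _ (seg_olt x) b.
  - by exists y.
  - by case: nbx; exists x; right; exact: oiso_sym.
  - by case: nbx; exists x; left.
have fE x y : orel (f x) (f y) = orel x y.
  rewrite !orel_seg; apply: asbool_equiv_eq; split=> h.
    apply: ole_trans (ole_trans h _); first by right.
    by right; exact: oiso_sym.
  apply: (ole_trans _ (ole_trans h _)); last by right.
  by right; exact: oiso_sym.
have finj : injective f.
  by move=> x y fxy; apply: seg_inj; apply: oiso_trans (fP x) _;
    rewrite fxy; exact: oiso_sym.
have fdown x z : ~~ orel (f x) z -> exists x', f x' = z.
  move=> /seg_lt zx; have [x' zx'] := olt_oiso zx (oiso_sym (fP x)).
  exists (val x'); apply: seg_inj.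
  apply: oiso_trans (oiso_sym (fP _)) _.
  by apply: oiso_sym; apply: oiso_trans zx' _; exact: seg_seg.
left; have [fsurj|nfsurj] := pselect (forall z, exists x, f x = z).
  right; exists f => //; have /choice[g gP] := fsurj.
  by exists g => // x; apply: finj; rewrite gP.
have [z0 nz0] : exists z, forall x, f x <> z.
  apply: contrapT => h; apply: nfsurj => z; apply: contrapT => h'.
  by apply: h; exists z => x fx; apply: h'; exists x.
have [|z [[/asboolP zP zmin] _]] := @orel_wo b (fun z => `[< forall x, f x <> z >]).
  by exists z0; exact/asboolP.
have fz x : ~~ orel z (f x).
  apply/negP => zf; have [E|/negP nE] := boolP (orel (f x) z).
    by apply: (zP x); apply: orel_anti; rewrite E zf.
  by case: (fdown x z (introN idP nE)) => x' /zP.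
left; exists z; exists (fun x => exist _ (f x) (fz x) : seg z); last first.
  by move=> x y; exact: fE.
have /choice[g gP] : forall w : seg z, exists x, f x = val w.
  move=> w; apply: contrapT => h; have /negP := valP w; apply.
  by apply: zmin; apply/asboolP => x fx; apply: h; exists x.
exists g => [x|w]; last by apply: val_inj; rewrite /= gP.
by apply: finj; rewrite gP.
Qed.

Lemma nole_olt a b : ~ a <=o b -> b <o a.
Proof. by have [|] := ole_or_olt a b. Qed.

Lemma ole_max a b c : a <o c -> b <o c ->
  exists d, [/\ d <o c, a <=o d & b <=o d].
Proof.
move=> ac bc; have [ab|ba] := ole_or_olt a b.
  by exists b; split=> //; exact: ole_refl.
by exists a; split=> //; [exact: ole_refl | left].
Qed.

Lemma card_le_seg (a : Ord) (x : a) :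
  [set y | ~~ orel x y] #= [set: seg x].
Proof.
rewrite card_eq_le; apply/andP; split.
  apply: (card_le_of_rel (R := fun y z => y = val (z : seg x))).
    by move=> y xy; exists (exist _ y xy).
  by move=> y y' z _ _ -> ->.
apply: (card_le_of_rel (R := fun z y => y = val (z : seg x))).
  by move=> z _; exists (val z) => //; exact: (valP z).
by move=> z z' y _ _ -> E; exact: val_inj.
Qed.

Lemma ole_card_le a b : a <=o b -> [set: a] #<= [set: b].
Proof.
move=> [[x /oiso_card_eq ax]|/oiso_card_eq]; last first.
  by rewrite card_eq_le => /andP[].
rewrite (card_le_eql ax) -(card_le_eql (card_le_seg x)).
exact: card_leT.
Qed.

Lemma card_ltW (a b : Ord) : ~ ([set: b] #<= [set: a]) -> a <o b.
Proof. by move=> ba; apply: nole_olt => ab; apply: ba; exact: ole_card_le. Qed.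

(** * Least ordinals and cardinals *)

Lemma ominP (P : Ord -> Prop) a :
  P a -> P (omin P) /\ forall b, P b -> omin P <=o b.
Proof.
move=> Pa; rewrite /omin; case: pselect => [h|nh]; first by case: (cid h).
case: nh; elim/(well_founded_ind olt_wf): a Pa => a IH Pa.
have [[b ba Pb]|nb] := pselect (exists2 b, b <o a & P b); first exact: IH ba Pb.
by exists a; split=> // b Pb; have [//|ba] := ole_or_olt a b; case: nb; exists b.
Qed.

Lemma olt_omin (P : Ord -> Prop) a : a <o omin P -> ~ P a.
Proof. by move=> aP Pa; have [_ /(_ _ Pa) h] := ominP Pa; exact: ole_oltF h aP. Qed.

Lemma ord_exists T (A : set T) : exists k : Ord, [set: k] #= A.
Proof.
have [R Rwo] := well_ordering_principle {classic (set_type A)}.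
by exists (MkOrd Rwo); exact: card_setT.
Qed.

Lemma card_eq_card T (A : set T) : [set: card A] #= A.
Proof. by have [k kA] := ord_exists A; have [] := @ominP (fun k => [set: k] #= A) k kA. Qed.

Lemma card_min T (A : set T) (k : Ord) : [set: k] #= A -> card A <=o k.
Proof. by move=> kA; have [_] := @ominP (fun k => [set: k] #= A) k kA; exact. Qed.

Lemma cardinal_card T (A : set T) : cardinal (card A).
Proof.
move=> a aA aE; apply: (ole_oltF _ aA); apply: card_min.
exact: card_eq_trans aE (card_eq_card A).
Qed.

Lemma cardinal_ole (k a : Ord) : cardinal k ->
  [set: k] #<= [set: a] -> k <=o a.
Proof.
move=> kcard ka; have [//|ak] := ole_or_olt k a; case: (kcard a ak).
by rewrite card_eq_le ka ole_card_le//; left.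
Qed.

Lemma card_ole T (A : set T) (k : Ord) : A #<= [set: k] -> card A <=o k.
Proof.
move=> Ak; apply: cardinal_ole; first exact: cardinal_card.
by rewrite (card_le_eql (card_eq_card A)).
Qed.

Lemma olt_cardP T (A : set T) (k : Ord) : cardinal k ->
  card A <o k <-> ~ ([set: k] #<= A).
Proof.
move=> kcard; rewrite -(card_le_eqr (card_eq_card A)).
split=> [Ak kA|]; last exact: card_ltW.
by apply: ole_oltF Ak; exact: cardinal_ole.
Qed.

Lemma infinite_omega : infinite_set [set: omega].
Proof. exact/infiniteP/card_lexx. Qed.

Lemma ole_infinite (a b : Ord) : a <=o b -> infinite_set [set: a] ->
  infinite_set [set: b].
Proof. by move=> /ole_card_le ab; exact/contra_not/card_le_finite. Qed.

Lemma omega_ole (a : Ord) : infinite_set [set: a] -> omega <=o a.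
Proof.
move=> ainf; have [//|[n an]] := ole_or_olt omega a; case: ainf.
apply/(card_le_finite _ (finite_II n)).
rewrite (card_le_eql (oiso_card_eq an)) -(card_le_eql (card_le_seg n)).
by apply: subset_card_le => m /=; rewrite -ltnNge.
Qed.

(** * Squares of infinite ordinals *)

Definition lex_rel (a b : Ord) : rel (a * b) :=
  fun p q => orel p.1 q.1 && (orel q.1 p.1 ==> orel p.2 q.2).

Lemma lex_wo (a b : Ord) : well_order (@lex_rel a b).
Proof.
apply: antisymmetric_well_order => [[x y] [x' y']|A [[x0 y0] A0]].
  rewrite /lex_rel /= => /andP[/andP[xx' yy'] /andP[x'x y'y]].
  rewrite xx' x'x /= in yy' y'y.
  by congr pair; apply: orel_anti; rewrite ?xx' ?yy'.
have [|x [[/asboolP[y1 A1] xmin] _]] :=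
    @orel_wo a (fun x => `[< exists y, (x, y) \in A >]).
  by exists x0; apply/asboolP; exists y0.
have [|y [[Ay ymin] _]] := @orel_wo b (fun y => (x, y) \in A).
  by exists y1.
exists (x, y); split=> // -[x' y'] A'; rewrite /lex_rel /=.
have xx' : orel x x' by apply: xmin; apply/asboolP; exists y'.
rewrite xx' /=; apply/implyP => x'x; apply: ymin.
by have <- : x' = x by apply: orel_anti; rewrite x'x xx'.
Qed.

Definition olex (a b : Ord) : Ord := MkOrd (@lex_wo a b).

Lemma pull_wo (T : Type) (a : Ord) (f : T -> a) : injective f ->
  well_order (fun x y => orel (f x) (f y)).
Proof.
move=> finj; apply: antisymmetric_well_order => [x y xy|A [x0 A0]].
  by apply: finj; exact: orel_anti.
have [|z [[/asboolP[x Ax <-] zmin] _]] :=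
    @orel_wo a (fun z => `[< exists2 x, x \in A & f x = z >]).
  by exists (f x0); apply/asboolP; exists x0.
by exists x; split=> // y Ay; apply: zmin; apply/asboolP; exists y.
Qed.

Definition omax2 (a : Ord) (x y : a) : a := if orel x y then y else x.

Lemma omax2_l (a : Ord) (x y : a) : orel x (omax2 x y).
Proof. by rewrite /omax2; case: ifP => // _; exact: orel_refl. Qed.

Lemma omax2_r (a : Ord) (x y : a) : orel y (omax2 x y).
Proof.
rewrite /omax2; case: ifP => [_|xy]; first exact: orel_refl.
by have := orel_total x y; rewrite xy.
Qed.

Lemma godel_inj (a : Ord) :
  injective (fun p : a * a => (omax2 p.1 p.2, p) : olex a (olex a a)).
Proof. by move=> p q []. Qed.

(** Goedel's order on pairs: compare maxima, then lexicographically. The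
    predecessors of a pair with maximum [m] then lie in the square of the set of
    points up to [m]. *)
Definition godel (a : Ord) : Ord := MkOrd (pull_wo (@godel_inj a)).

Lemma setC_orel (a : Ord) (x : a) :
  [set y | orel y x] = x |` [set y | ~~ orel x y].
Proof.
apply/seteqP; split=> y /=.
  by move=> yx; case E: (orel x y); [left; apply: orel_anti; rewrite yx E|right].
move=> [->|xy]; first exact: orel_refl.
by have := orel_total x y; rewrite (negbTE xy).
Qed.

(** If [a] does not embed in a proper segment but the square, in Goedel's order,
    were longer than [a], then [a] would embed in the square of a segment, hence
    by induction in that segment. *)
Theorem card_square (a : Ord) : infinite_set [set: a] ->
  [set: a] `*` [set: a] #<= [set: a].
Proof.
elim/(well_founded_ind olt_wf): a => a IH ainf.
have [[x ax]|nax] := pselect (exists x : a, [set: a] #<= [set: seg x]).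
  apply: card_le_trans (card_leX ax ax) _.
  apply: card_le_trans (IH _ (seg_olt x) _) (ole_card_le (oltW (seg_olt x))).
  by move=> /(card_le_finite ax).
have gE : [set: a] `*` [set: a] = [set: godel a] by apply/seteqP; split.
rewrite gE; have [/ole_card_le//|[p ap]] := ole_or_olt (godel a) a.
pose m := omax2 p.1 p.2.
have am : [set: a] #<= [set y | orel y m] `*` [set y | orel y m].
  rewrite (card_le_eql (oiso_card_eq ap)) -(card_le_eql (card_le_seg p)).
  apply: subset_card_le => q /= pq.
  have {pq} : ~~ orel m (omax2 q.1 q.2) \/ omax2 q.1 q.2 = m.
    case: (boolP (orel m _)) => h; [right|by left].
    move: pq; rewrite /= /lex_rel/= -/m h /= negb_imply => /andP[h' _].
    by apply: orel_anti; rewrite h h'.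
  move=> qm; suff qlem : orel (omax2 q.1 q.2) m.
    split; [exact: orel_trans (omax2_l _ _) qlem|].
    exact: orel_trans (omax2_r _ _) qlem.
  case: qm => [/negbTE h|->]; last exact: orel_refl.
  by have := orel_total m (omax2 q.1 q.2); rewrite h.
have [mfin|minf] := pselect (finite_set [set y | orel y m]).
  by case: ainf; apply: card_le_finite am (finite_setX mfin mfin).
have minf' : infinite_set [set y | ~~ orel m y].
  move=> fin; apply: minf; rewrite setC_orel finite_setU; split=> //.
have mseg : [set y | orel y m] #<= [set: seg m].
  rewrite setC_orel -(card_le_eqr (card_le_seg m)); exact: card_le_setU1.
case: nax; exists m; apply: card_le_trans am _.
apply: card_le_trans (card_leX mseg mseg) (IH _ (seg_olt m) _).
by rewrite -(eq_finite_set (card_le_seg m)).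
Qed.

Lemma card_le_bigcup I T (D : set I) (F : I -> set T) (k : Ord) :
  infinite_set [set: k] -> D #<= [set: k] ->
  (forall i, D i -> F i #<= [set: k]) ->
  \bigcup_(i in D) F i #<= [set: k].
Proof.
move=> kinf Dk Fk; apply: card_le_trans (card_square kinf).
exact: card_le_bigcupX.
Qed.

Lemma card_leU T (A B : set T) (k : Ord) : infinite_set [set: k] ->
  A #<= [set: k] -> B #<= [set: k] -> A `|` B #<= [set: k].
Proof.
move=> kinf Ak Bk; rewrite -bigcup2E; apply: card_le_bigcup => //.
  exact/infiniteP.
by move=> [|[|n]] _ //=; exact: card_ge0.
Qed.

(** * Counting the cardinals below an ordinal *)

(** The iterated successors are defined by recursion over representatives, and
    depend only on the order type because their defining predicate does. *)
Lemma card_succ_iter_iso (k a b : Ord) : a =o b ->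
  card_succ_iter k a = card_succ_iter k b.
Proof.
move=> ab; rewrite !card_succ_iterE; congr omin; apply/funext => m.
congr and3; apply/propext; split=> h c ca; apply: h.
  exact: olt_oiso ca (oiso_sym ab).
exact: olt_oiso ca ab.
Qed.

(** A cardinal above all earlier iterates would meet the condition of which
    the [b]-th iterate is the least solution. *)
Lemma olt_card_succ_iter (k b m : Ord) : cardinal m -> k <=o m ->
  m <o card_succ_iter k b -> exists2 c, c <o b & m <=o card_succ_iter k c.
Proof.
rewrite card_succ_iterE => mcard km mb; apply: contrapT => h.
apply: (olt_omin mb); split=> // c cb; apply: nole_olt => mc.
by apply: h; exists c.
Qed.

(** Descend from [b] to ever earlier iterates that bound [m]; the descent can
    only end at an iterate equal to [m]. *)
Lemma card_succ_iter_code (k b m : Ord) : cardinal m -> k <=o m ->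
  m <o card_succ_iter k b -> exists x : b, m =o card_succ_iter k (seg x).
Proof.
move=> mcard km; suff h : m <o card_succ_iter k b ->
    exists2 c, c <o b & m =o card_succ_iter k c.
  by move=> /h[c [x cx] mc]; exists x; rewrite -(card_succ_iter_iso k cx).
elim/(well_founded_ind olt_wf): b => b IH mb.
have [c cb [mc|mc]] := olt_card_succ_iter mcard km mb; last by exists c.
by have [d dc md] := IH _ cb mc; exists d => //; exact: olt_trans dc cb.
Qed.

Lemma card_seg_below (a c : Ord) : [set x : a | seg x <o c] #<= [set: c].
Proof.
apply: (card_le_of_rel (R := fun x z => seg x =o seg z)).
  by move=> x [z xz]; exists z.
by move=> x x' z _ _ xz xz'; apply: seg_inj; exact: oiso_trans xz (oiso_sym xz').
Qed.

(** A cardinal in this range is recorded by its index among the successors of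
    [k], which determines it. *)
Lemma card_cardinals_below (a k b : Ord) :
  [set x : a | [/\ cardinal (seg x), k <=o seg x &
                  seg x <o card_succ_iter k b]] #<= [set: b].
Proof.
apply: (card_le_of_rel (R := fun x z => seg x =o card_succ_iter k (seg z))).
  by move=> x [xcard kx xb]; have [z] := card_succ_iter_code xcard kx xb; exists z.
by move=> x x' z _ _ xz xz'; apply: seg_inj; exact: oiso_trans xz (oiso_sym xz').
Qed.

(** If every [aleph b] with [b] below [k] stayed below [k], then [aleph k] would
    be at most [k]. It cannot be smaller: at the least [a] with [aleph a] below
    [a], monotonicity would make [aleph a] an earlier such ordinal. So [k] would
    be a fixed point. *)
Lemma nfixed_le_aleph (k : Ord) : cardinal k -> omega <=o k ->
  ~ aleph_fixed_point k -> exists2 d, d <o k & k <=o aleph d.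
Proof.
move=> kcard ok nfix; apply: contrapT => h; apply: nfix.
have kalephs a : a <o k -> aleph a <o k.
  by move=> ak; apply: nole_olt => ka; apply: h; exists a.
have alephP a : a <=o k ->
    (forall b, b <o a -> aleph b <o aleph a) /\ aleph a <=o k.
  move=> ak; have Pk : [/\ cardinal k, omega <=o k &
      forall b, b <o a -> card_succ_iter omega b <o k].
    by split=> // b ba; exact/kalephs/(olt_ole_trans ba).
  have := ominP (P := fun m => [/\ cardinal m, omega <=o m &
    forall b, b <o a -> card_succ_iter omega b <o m]) Pk.
  by rewrite -card_succ_iterE => -[[_ _ lt] le]; split; [exact: lt|exact: le].
have aleph_ge a : a <=o k -> ~ aleph a <o a.
  elim/(well_founded_ind olt_wf): a => a IH ak aa.
  apply: (IH _ aa); first by left; exact: olt_ole_trans aa ak.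
  exact: (alephP _ ak).1.
apply: ole_anti; last exact: (alephP _ (ole_refl k)).2.
have [//|kk] := ole_or_olt k (aleph k).
by case: (aleph_ge _ (ole_refl k)).
Qed.

(** Split the cardinals below [lambda] at [omega] and [chi]. The finite ones
    are counted by [omega]; those up to [chi] by some [d] below [chi] with [chi]
    at most [aleph d]; the others by some [b] below [chi] with [lambda] at most
    the [b]-th successor of [chi]. *)
Lemma few_cardinals (chi lambda : Ord) :
  cardinal chi -> omega <o chi -> ~ aleph_fixed_point chi ->
  cardinal lambda -> chi <o lambda -> lambda <o card_succ_iter chi chi ->
  exists kappa : Ord, [/\ cardinal kappa, infinite_set [set: kappa],
    kappa <o chi & forall a : Ord, a <=o lambda ->
      [set x : a | cardinal (seg x)] #<= [set: kappa]].
Proof.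
move=> ccard oc nfix lcard cl lc.
have [d dc cd] := nfixed_le_aleph ccard (oltW oc) nfix.
have [b bc lb] := olt_card_succ_iter lcard (oltW cl) lc.
have [e [ec oe de]] := ole_max oc dc.
have [f [fc ef bf]] := ole_max ec bc.
have fE : [set: card [set: f]] #= [set: f] := card_eq_card _.
have few (g : Ord) : g <=o f -> [set: g] #<= [set: card [set: f]].
  by move=> gf; rewrite (card_le_eqr fE); exact: ole_card_le.
have kinf : infinite_set [set: card [set: f]].
  rewrite (eq_finite_set fE); apply: ole_infinite infinite_omega.
  exact: ole_trans oe ef.
exists (card [set: f]); split=> //; first exact: cardinal_card.
  by apply: ole_olt_trans fc; exact/card_ole/card_lexx.
move=> a al; pose mid (k c : Ord) := [set x : a |
  [/\ cardinal (seg x), k <=o seg x & seg x <o card_succ_iter k c]].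
apply: (@card_le_trans _ _ _
    ([set x : a | seg x <o omega] `|` (mid omega d `|` mid chi b))); last first.
  apply: (card_leU kinf); last apply: (card_leU kinf).
  - exact: card_le_trans (card_seg_below _ _) (few _ (ole_trans oe ef)).
  - exact: card_le_trans (card_cardinals_below _ _ _) (few _ (ole_trans de ef)).
  - exact: card_le_trans (card_cardinals_below _ _ _) (few _ bf).
apply: subset_card_le => x xcard.
have [ox|xo] := ole_or_olt omega (seg x); [right | by left].
have [cx|xc] := ole_or_olt chi (seg x); [right | left]; split=> //.
  exact: olt_ole_trans (olt_ole_trans (seg_olt x) al) lb.
exact: olt_ole_trans xc cd.
Qed.

(** * Covering small subsets *)

(** Smallness of a set is expressed as [nu] not embedding into it, which for a
    cardinal [nu] means a size less than [nu]. *)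
Definition coverable (kappa nu lambda : Ord) T (A : set T) : Prop :=
  exists X : set (set T), [/\ X #<= [set: lambda],
    forall x, X x -> ~ ([set: nu] #<= x) &
    forall b, b `<=` A -> ~ ([set: nu] #<= b) ->
      exists Q, [/\ Q `<=` X, Q #<= [set: kappa] & b `<=` \bigcup_(x in Q) x]].

Lemma coverable_le kappa nu lambda T U (A : set T) (B : set U) :
  A #<= B -> coverable kappa nu lambda B -> coverable kappa nu lambda A.
Proof.
move=> /card_le_rel[R [Rtot Rinj Rfun]] [X [Xl Xnu Xcov]].
pose pre (x : set U) := [set t | exists2 u, x u & R t u].
exists (pre @` X); split=> [|_ [x Xx <-]|b bA bnu].
- exact: card_le_trans (card_image_le _ _) Xl.
- apply: contra_not (Xnu x Xx) => nux; apply: card_le_trans nux _.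
  apply: (card_le_of_rel (R := R)) => [t [u xu tu]|t t' u _ _]; first by exists u.
  exact: Rinj.
pose fb := [set u | B u /\ exists2 t, b t & R t u].
have [||Q [QX Qk fbQ]] := Xcov fb; first by move=> u [].
  apply: contra_not bnu => nufb; apply: card_le_trans nufb _.
  apply: (card_le_of_rel (R := fun u t => R t u)).
    by move=> u [_ [t bt tu]]; exists t.
  by move=> u u' t _ _; exact: Rfun.
exists (pre @` Q); split; first exact: image_subset.
  exact: card_le_trans (card_image_le _ _) Qk.
move=> t bt; have [u Bu tu] := Rtot _ (bA _ bt).
have [x Qx xu] : (\bigcup_(x in Q) x) u by apply: fbQ; split=> //; exists t.
by exists (pre x); [exists x | exists u].
Qed.

(** The families of the members of [F] are pooled. Covering [b] uses [J] to split
    it into [kappa] many pieces, each covered by [kappa] many sets; the bound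
    [kappa] survives because [kappa] times [kappa] is [kappa]. *)
Lemma coverable_bigcup (kappa nu lambda : Ord) I T (D : set I) (F : I -> set T)
    (A : set T) :
  infinite_set [set: kappa] -> infinite_set [set: lambda] ->
  D #<= [set: lambda] ->
  (forall i, D i -> coverable kappa nu lambda (F i)) ->
  (forall b, b `<=` A -> ~ ([set: nu] #<= b) ->
     exists J, [/\ J `<=` D, J #<= [set: kappa] & b `<=` \bigcup_(i in J) F i]) ->
  coverable kappa nu lambda A.
Proof.
move=> kinf linf Dl Fcov AF.
have /choice[X XP] : forall i, exists X : set (set T), D i ->
    [/\ X #<= [set: lambda], forall x, X x -> ~ ([set: nu] #<= x) &
    forall b, b `<=` F i -> ~ ([set: nu] #<= b) ->
      exists Q, [/\ Q `<=` X, Q #<= [set: kappa] & b `<=` \bigcup_(x in Q) x]].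
  move=> i; have [/Fcov[X XP]|nDi] := pselect (D i); first by exists X.
  by exists set0.
exists (\bigcup_(i in D) X i); split=> [|x [i Di]|b bA bnu].
- by apply: card_le_bigcup => // i /XP[].
- by have [_ + _] := XP _ Di; exact.
have [J [JD Jk bJ]] := AF _ bA bnu.
have /choice[Q QP] : forall i, exists Q, J i ->
    [/\ Q `<=` X i, Q #<= [set: kappa] & b `&` F i `<=` \bigcup_(x in Q) x].
  move=> i; have [Ji|nJi] := pselect (J i); last by exists set0.
  have [_ _ /(_ (b `&` F i))[||Q QP]] := XP _ (JD _ Ji).
  - exact: subIsetr.
  - apply: contra_not bnu => h; apply: card_le_trans h _.
    by apply: subset_card_le => t [].
  by exists Q.
exists (\bigcup_(i in J) Q i); split=> [x [i Ji Qx]||t bt].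
- by exists i; [exact: JD | have [+ _ _] := QP _ Ji; exact].
- by apply: card_le_bigcup => // i /QP[].
have [i Ji Ft] := bJ _ bt; have [_ _ /(_ t)[//|x Qx xt]] := QP _ Ji.
by exists x => //; exists i.
Qed.

(** By induction on [a]; the only case that is not immediate is that of a
    cardinal [a] into which [nu] embeds. When the cardinals below [a] are
    cofinal, [a] is a union of [kappa] segments. Otherwise [a] is a successor
    cardinal, hence regular, and each small subset lies in one segment. *)
Lemma coverable_ord (kappa nu lambda : Ord) :
  infinite_set [set: kappa] -> infinite_set [set: nu] ->
  infinite_set [set: lambda] ->
  (forall a : Ord, a <=o lambda ->
     [set x : a | cardinal (seg x)] #<= [set: kappa]) ->
  forall a : Ord, a <=o lambda -> coverable kappa nu lambda [set: a].
Proof.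
move=> kinf nuinf linf few; elim/(well_founded_ind olt_wf) => a IH al.
have [nua|nua] := pselect ([set: nu] #<= [set: a]); last first.
  exists [set [set: a]]; split=> [|x ->//|b bA bnu]; first exact: card_le_set1.
  exists [set [set: a]]; split=> //; first exact: card_le_set1.
  by move=> x bx; exists [set: a].
have segcov (x : a) : coverable kappa nu lambda [set y | ~~ orel x y].
  apply: (@coverable_le _ _ _ _ _ _ [set: seg x]).
    by rewrite -(card_le_eqr (card_le_seg x)) card_lexx.
  by apply: (IH _ (seg_olt x)); left; exact: olt_ole_trans (seg_olt x) al.
have [acard|nacard] := pselect (cardinal a); last first.
  have [c ca cE] : exists2 c, c <o a & [set: c] #= [set: a].
    apply: contrapT => h; apply: nacard => c ca cE.
    by apply: h; exists c.
  apply: (@coverable_le _ _ _ _ _ _ [set: c]).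
    by rewrite -(card_le_eql cE) card_lexx.
  by apply: (IH _ ca); left; exact: olt_ole_trans ca al.
pose C := [set x : a | cardinal (seg x)].
have Ck : C #<= [set: kappa] := few _ al.
have al' : [set: a] #<= [set: lambda] := ole_card_le al.
have [cofC|ncofC] := pselect (forall y : a, exists2 x, C x & ~~ orel x y).
  apply: (coverable_bigcup (D := C) (F := fun x => [set y | ~~ orel x y])) => //.
    exact: card_le_trans (card_leT _) al'.
  move=> b _ _; exists C; split=> // y _; have [x Cx xy] := cofC y.
  by exists x.
have [m mC] : exists m : a, forall x, C x -> orel x m.
  apply: contrapT => h; apply: ncofC => y; apply: contrapT => h'.
  by apply: h; exists y => x Cx; apply: contrapT => /negP xy; apply: h'; exists x.
(* By the choice of m, sets smaller than a embed into the segment of m. *)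
have small_m T (B : set T) : ~ ([set: a] #<= B) -> B #<= [set: seg m].
  move=> aB; have [x Bx] : card B <o a by apply/olt_cardP.
  rewrite -(card_le_eql (card_eq_card B)) (card_le_eql (oiso_card_eq Bx)).
  apply: ole_card_le; apply/asboolP; rewrite -orel_seg; apply: mC => c cx cE.
  have cB : [set: c] #= B.
    apply: card_eq_trans cE (card_eq_trans _ (card_eq_card B)).
    exact/card_esym/oiso_card_eq.
  exact: ole_oltF (card_min cB) (olt_oiso cx (oiso_sym Bx)).
have ainf : infinite_set [set: a] by move=> /(card_le_finite nua).
apply: (coverable_bigcup (D := [set: a])
                         (F := fun x => [set y | ~~ orel x y])) => //.
move=> b _ bnu; have [[y by_]|unb] :=
    pselect (exists y : a, b `<=` [set z | ~~ orel y z]).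
  exists [set y]; split=> //; first exact: card_le_set1.
  by move=> z bz; exists y => //; exact: by_.
(* An unbounded b makes a the union, over b, of sets that embed in the segment
   of m up to one point, while b embeds there too: a is then too small. *)
exfalso.
have bm : b #<= [set: seg m].
  by apply: small_m => ab; apply: bnu; exact: card_le_trans nua ab.
have seg_m (x : a) : [set y | ~~ orel x y] #<= [set: seg m].
  apply: small_m => ax; apply: (acard _ (seg_olt x)).
  by rewrite card_eq_le (ole_card_le (oltW (seg_olt x))) -(card_le_eqr (card_le_seg x)).
have aU : [set: a] `<=` \bigcup_(x in b) [set y | orel y x].
  move=> y _; apply: contrapT => h; apply: unb; exists y => z bz /=.
  by apply/negP => yz; apply: h; exists z.
have [mfin|minf] := pselect (finite_set [set: seg m]).
  apply: ainf; apply: sub_finite_set aU _; apply: bigcup_finite.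
    exact: card_le_finite bm mfin.
  move=> x _; rewrite setC_orel finite_setU; split=> //.
  exact: card_le_finite (seg_m x) mfin.
apply: (acard _ (seg_olt m)); rewrite card_eq_le (ole_card_le (oltW (seg_olt m))).
apply: card_le_trans (subset_card_le aU) _; apply: card_le_bigcup => // x _.
have [xfin|xinf] := pselect (finite_set [set y | ~~ orel x y]).
  have : finite_set [set y | orel y x] by rewrite setC_orel finite_setU.
  by move=> /finite_set_countable fc; apply: card_le_trans fc _; exact/infiniteP.
by rewrite setC_orel; apply: card_le_trans (card_le_setU1 _ xinf) (seg_m x).
Qed.

Lemma cov_le (kappa lambda tau nu sigma : Ord) :
  cardinal nu -> cardinal sigma -> kappa <o sigma ->
  coverable kappa nu lambda [set: tau] -> cov tau nu nu sigma <=o lambda.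
Proof.
move=> nucard scard ks [X [Xl Xnu Xcov]].
have Xcovers : covers (r1 := tau) nu nu sigma X.
  split=> [x Xx|b [_ bnu]]; first by split=> //; apply/olt_cardP => //; exact: Xnu.
  have [||Q [QX Qk bQ]] := Xcov b; first by [].
    by apply/olt_cardP.
  exists Q => //; split=> //; exact: ole_olt_trans (card_ole Qk) ks.
apply: ole_trans (card_ole Xl).
have [_] := @ominP (fun k => exists2 X, @covers tau nu nu sigma X & k =o card X)
  (card X) (ex_intro2 _ _ X Xcovers (oiso_refl _)).
by apply; exists X => //; exact: oiso_refl.
Qed.

Lemma card_succP (k m : Ord) : cardinal m -> k <o m ->
  [/\ cardinal (card_succ k), k <o card_succ k & card_succ k <=o m].
Proof.
move=> mcard km.
have [[? ?] min] := ominP (P := fun m => cardinal m /\ k <o m) (conj mcard km).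
by split=> //; exact: min.
Qed.

(** The covering number is at most [lambda] already when the covering families
    have size at most [kappa], a bound on the number of cardinals below
    [lambda]. Of the two successors taken, the first turns this bound into a
    strict one; the second leaves room for a revision witness strictly below
    every admissible [nu]. *)
Theorem proposition2p8 (chi lambda : Ord) :
  limit_cardinal chi -> omega <o chi -> ~ aleph_fixed_point chi ->
  cardinal lambda -> chi <o lambda -> lambda <o card_succ_iter chi chi ->
  alpha chi <=o lambda /\
  exists sigma : Ord,
    [/\ cardinal sigma, omega <=o sigma, sigma <o chi &
        forall nu : Ord,
          cardinal nu -> sigma <=o nu -> nu <=o card_succ chi ->
          cov lambda nu nu sigma <=o lambda /\ revision_cardinal lambda nu].
Proof.
move=> [ccard _ climit] oc nfix lcard cl lc.
have [kappa [kcard kinf kc few]] := few_cardinals ccard oc nfix lcard cl lc.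
have linf : infinite_set [set: lambda].
  exact: ole_infinite (oltW (olt_trans oc cl)) infinite_omega.
have covle tau nu sigma : cardinal nu -> cardinal sigma -> kappa <o sigma ->
    omega <=o nu -> tau <=o lambda -> cov tau nu nu sigma <=o lambda.
  move=> nucard scard ks onu tl; apply: (cov_le nucard scard ks).
  apply: coverable_ord => //; exact: ole_infinite onu infinite_omega.
pose sigma0 := card_succ kappa; pose sigma := card_succ sigma0.
have [s0card ks0 _] := card_succP ccard kc.
have s0c : sigma0 <o chi := climit _ kcard kc.
have [scard s0s _] := card_succP ccard s0c.
have sc : sigma <o chi := climit _ s0card s0c.
have ks : kappa <o sigma := olt_trans ks0 s0s.
have ok : omega <=o kappa := omega_ole kinf.
have os0 : omega <=o sigma0 := ole_trans ok (oltW ks0).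
have os : omega <=o sigma := ole_trans ok (oltW ks).
split.
  apply: (@ole_trans _ (alpha2 chi sigma)).
    have [_] := ominP (P := fun k => exists sigma, [/\ cardinal sigma,
      omega <=o sigma, sigma <o chi & k =o alpha2 chi sigma])
      (ex_intro _ sigma (And4 scard os sc (oiso_refl (alpha2 chi sigma)))).
    by apply; exists sigma; split=> //; exact: oiso_refl.
  pose covs k := exists tau nu, [/\ cardinal tau, cardinal nu,
    [/\ sigma <=o nu, nu <=o tau & tau <o chi] & k =o cov tau nu nu sigma].
  have ub : forall k, covs k -> k <=o lambda.
    move=> k [tau [nu [_ nucard [snu _ tc] kE]]].
    apply: ole_trans (or_intror kE) _; apply: covle => //.
      exact: ole_trans os snu.
    by left; exact: olt_trans tc cl.
  exact: (ominP (P := fun b => forall k, covs k -> k <=o b) ub).2 ub.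
exists sigma; split=> // nu nucard snu nuc.
have onu : omega <=o nu := ole_trans os snu.
split; first by apply: covle => //; exact: ole_refl.
split=> //; first by apply: ole_trans nuc _; have [] := card_succP lcard cl.
exists sigma0; split=> //.
- by left; apply: olt_ole_trans os0; exact: seg_olt.
- exact: olt_ole_trans s0s snu.
- by apply: covle => //; exact: ole_refl.
Qed.
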